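(* Let $t,n$ be positive integers with $t\le 2n-2$. Then $dyn_t(K_n\Box K_n)=\left\lceil \dfrac t2\right\rceil^2$ if $t$ is odd, and $dyn_t(K_n\Box K_n)=\dfrac t2\left(\dfrac t2+1\right)$ if $t$ is even.
   Context: $K_n$ is the complete graph on $n$ vertices; $G\Box H$ is the Cartesian product (vertex set $V(G)\times V(H)$, $(u,v)\sim(u',v')$ iff $u=u'$ and $vv'\in E(H)$, or $v=v'$ and $uu'\in E(G)$). For constant threshold $t$, a set $D$ of vertices is a $t$-dynamic monopoly if starting from $D$ and repeatedly adding any vertex having at least $t$ neighbors in the current set eventually yields all vertices; $dyn_t$ is the minimum size of a $t$-dynamic monopoly. *)

(* Defs.v *)
From mathcomp Require Import all_boot.
Set Implicit Arguments.
Unset Strict Implicit.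
Unset Printing Implicit Defensive.

(* A graph on a finite vertex type T is given by its adjacency relation. *)

Definition complete_graph (n : nat) : rel 'I_n := fun u v => u != v.
Arguments complete_graph n : clear implicits.

Definition cart_prod (T1 T2 : finType) (g : rel T1) (h : rel T2) :
  rel (T1 * T2) :=
  fun x y => ((x.1 == y.1) && h x.2 y.2) || ((x.2 == y.2) && g x.1 y.1).

Section DynamicMonopoly.
Variables (T : finType) (g : rel T) (t : nat).

Definition activates (A B : {set T}) : bool :=
  [exists v, (t <= #|[set u in A | g v u]|) && (B == v |: A)].

(* [connect] is the reflexive transitive closure.  As [activates] is monotone
   in A, some activation sequence from D reaches the full vertex set iff every
   sequence that is continued as long as possible does. *)
Definition dynamic_monopoly (D : {set T}) : bool :=
  connect activates D [set: T].

(* The full vertex set is a dynamic monopoly, so the minimum exists. *)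
Definition dyn : nat :=
  #|[arg min_(D < [set: T] | dynamic_monopoly D) #|D|]|.

Lemma dynamic_monopolyT : dynamic_monopoly [set: T].
Proof. exact: connect0. Qed.

Lemma dyn_min D : dynamic_monopoly D -> dyn <= #|D|.
Proof.
rewrite /dyn; case: arg_minnP => [|A _ minA]; first exact: dynamic_monopolyT.
exact: minA.
Qed.

Lemma dyn_attained : exists2 D, dynamic_monopoly D & #|D| = dyn.
Proof.
rewrite /dyn; case: arg_minnP => [|A dA _]; first exact: dynamic_monopolyT.
by exists A.
Qed.

End DynamicMonopoly.

(* Main.v *)
Require Import Defs.
From mathcomp Require Import all_boot.
From mathcomp Require Import zify.

Set Implicit Arguments.
Unset Strict Implicit.
Unset Printing Implicit Defensive.

(** Write [t + 1 = a + b] with [a = uphalf t] and [b = t./2 + 1]; the value is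
    [a * b] in both parities.  A cell being activated sees at least [a] active
    cells in its row or at least [b] in its column.

    Lower bound: cover the activated cells by full rows and columns, adding a
    line whenever a new cell is activated.  If [x] rows and [y] columns are
    already in the cover, a new row contains at least [a - y] uncovered cells
    of [D], and a new column at least [b - x].  These are exactly the
    decrements of the potential [(b - x) * (a - y)], which starts at [a * b].

    Upper bound: let [D] be the set of the cells [(r, c)] with [c + p <= r] or
    [r + q <= c], where [p = n - t./2] and [q = n - uphalf t].  A cell
    outside [D] has [(n - 1 - c) + (n - 1 - r)] neighbours further along its
    row or column, and [(r + 1 - p) + (c + 1 - q)] earlier neighbours in [D];
    these add up to [t], so the cells can be activated in decreasing order of
    [r + c]. *)

Notation rook m n := (cart_prod (complete_graph m) (complete_graph n)).

(** * Counting tools and activation sequences *)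

Lemma leq_card_disjointU (T : finType) (A B C : {set T}) :
    A \subset C -> B \subset C -> (forall x, x \in A -> x \notin B) ->
  #|A| + #|B| <= #|C|.
Proof.
move=> sAC sBC dAB; rewrite -cardsUI [A :&: B](_ : _ = set0).
  by rewrite cards0 addn0 subset_leq_card // subUset sAC.
apply/setP=> x; rewrite !inE; apply/negP=> /andP[/dAB xB]; exact/negP.
Qed.

Lemma card_row (T1 T2 : finType) (i : T1) (K : {set T2}) :
  #|[set (i, y) | y in K]| = #|K|.
Proof. by apply: card_imset => y z []. Qed.

Lemma card_col (T1 T2 : finType) (j : T2) (K : {set T1}) :
  #|[set (x, j) | x in K]| = #|K|.
Proof. by apply: card_imset => x z []. Qed.

Section Monopoly.
Variables (T : finType) (g : rel T) (t : nat).

Lemma dynamic_monopoly_ind (P : {set T} -> Prop) (D : {set T}) :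
    dynamic_monopoly g t D -> P D ->
    (forall (A : {set T}) v, P A -> t <= #|[set u in A | g v u]| ->
       P (v |: A)) ->
  P [set: T].
Proof.
move=> /connectP [s sP ->] PD stepP; elim: s D sP PD => //= B s IHs D.
case/andP=> /existsP[v /andP[tv /eqP->]] sP PD.
by apply: IHs sP _; apply: stepP.
Qed.

(** It suffices that no proper superset of [D] is stuck: each new vertex shrinks the complement,
    whose size drives the induction. Asking for [v \notin A] matters, since [activates] also allows
    adding a vertex already in [A]. *)
Lemma dynamic_monopolyP (D : {set T}) :
    (forall A : {set T}, D \subset A -> A != [set: T] ->
       exists2 v, v \notin A & t <= #|[set u in A | g v u]|) ->
  dynamic_monopoly g t D.
Proof.
move=> grow; rewrite /dynamic_monopoly.
suff reach k (A : {set T}) : #|~: A| <= k -> D \subset A ->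
    connect (activates g t) A [set: T] by exact: reach (leqnn _) (subxx D).
elim: k A => [|k IHk] A leAk sDA.
  suff /eqP-> : A == [set: T] by exact: connect0.
  by rewrite -(inj_eq (@setC_inj T)) setCT -cards_eq0 -leqn0.
have [->|A_neqT] := eqVneq A [set: T]; first exact: connect0.
have [v vA tv] := grow A sDA A_neqT.
apply: (@connect_trans _ _ (v |: A)).
  by apply: connect1; apply/existsP; exists v; rewrite tv eqxx.
apply: IHk; last by apply: subset_trans sDA _; exact: subsetU1.
move: leAk; rewrite [#|~: A|](cardsD1 v) inE vA add1n ltnS.
congr (_ <= k); apply: eq_card => x; rewrite !inE; case: eqP => //=.
Qed.

End Monopoly.

(** * Lower bound by covering lines *)

Section LowerBound.
Variables (m n a b : nat) (D : {set 'I_m * 'I_n}).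
Implicit Types (A : {set 'I_m * 'I_n}) (X : {set 'I_m}) (Y : {set 'I_n}).

Definition lines X Y := [set v : 'I_m * 'I_n | (v.1 \in X) || (v.2 \in Y)].

Definition line_cover A X Y : Prop :=
  A \subset D :|: lines X Y /\
  a * b <= #|D :&: lines X Y| + (b - #|X|) * (a - #|Y|).

(** The inequality can be strict: if [v] is in [A], the right side counts it twice. *)
Lemma rook_neighbors A v :
  #|[set u in A | rook m n v u]| <=
    #|[set y | (v.1, y) \in A]| + #|[set x | (x, v.2) \in A]|.
Proof.
set R := [set y | (v.1, y) \in A]; set C := [set x | (x, v.2) \in A].
rewrite -(card_row v.1 R) -(card_col v.2 C).
apply: leq_trans (leq_card_setU _ _); apply: subset_leq_card.
apply/subsetP=> -[x y]; rewrite !inE /cart_prod /= => /andP[Axy].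
case/orP=> /andP[/eqP e _]; apply/orP; [left | right]; apply/imsetP.
  by exists y; rewrite ?inE e.
by exists x; rewrite ?inE e.
Qed.

Lemma line_cover_row A X Y i :
    line_cover A X Y -> i \notin X -> a <= #|[set y | (i, y) \in A]| ->
  line_cover A (i |: X) Y.
Proof.
move=> [sA leD] iX le_a; split.
  apply: subset_trans sA (setUS _ _); apply/subsetP=> v; rewrite !inE.
  by case/orP=> ->; rewrite ?orbT.
(* As [i] is not in [X], an active cell of row [i] outside the columns [Y] lies in [D]; hence [K]
   has at least [a - #|Y|] elements, which pays for the drop of the potential. *)
set K := [set y | ((i, y) \in D) && (y \notin Y)].
have le_aK : a <= #|Y| + #|K|.
  apply: leq_trans le_a (leq_trans _ (leq_card_setU _ _)).
  apply: subset_leq_card; apply/subsetP=> y; rewrite !inE => Aiy.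
  move/subsetP/(_ _ Aiy): sA; rewrite !inE /= (negPf iX) /=.
  by case: (y \in Y); rewrite ?orbF ?andbT.
have leK : #|D :&: lines X Y| + #|K| <= #|D :&: lines (i |: X) Y|.
  rewrite -(card_row i K).
  apply: leq_card_disjointU => [||v].
  - by apply/setIS/subsetP=> v; rewrite !inE => /orP[]->; rewrite ?orbT.
  - apply/subsetP=> v /imsetP[y]; rewrite inE => /andP[Diy _] ->.
    by rewrite !inE Diy eqxx.
  rewrite !inE => /andP[_ vXY]; apply/imsetP=> -[y].
  rewrite inE => /andP[_ yY] e.
  by rewrite e /= (negPf iX) (negPf yY) in vXY.
rewrite cardsU1 iX; nia.
Qed.

Lemma line_cover_col A X Y j :
    line_cover A X Y -> j \notin Y -> b <= #|[set x | (x, j) \in A]| ->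
  line_cover A X (j |: Y).
Proof.
move=> [sA leD] jY le_b; split.
  apply: subset_trans sA (setUS _ _); apply/subsetP=> v; rewrite !inE.
  by case/orP=> ->; rewrite ?orbT.
set K := [set x | ((x, j) \in D) && (x \notin X)].
have le_bK : b <= #|X| + #|K|.
  apply: leq_trans le_b (leq_trans _ (leq_card_setU _ _)).
  apply: subset_leq_card; apply/subsetP=> x; rewrite !inE => Axj.
  move/subsetP/(_ _ Axj): sA; rewrite !inE /= (negPf jY) /=.
  by case: (x \in X); rewrite ?orbF ?andbT.
have leK : #|D :&: lines X Y| + #|K| <= #|D :&: lines X (j |: Y)|.
  rewrite -(card_col j K).
  apply: leq_card_disjointU => [||v].
  - by apply/setIS/subsetP=> v; rewrite !inE => /orP[]->; rewrite ?orbT.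
  - apply/subsetP=> v /imsetP[x]; rewrite inE => /andP[Dxj _] ->.
    by rewrite !inE Dxj eqxx orbT.
  rewrite !inE => /andP[_ vXY]; apply/imsetP=> -[x].
  rewrite inE => /andP[_ xX] e.
  by rewrite e /= (negPf xX) (negPf jY) in vXY.
rewrite cardsU1 jY; nia.
Qed.

Lemma line_coverU1 A X Y v :
  line_cover A X Y -> v \in D :|: lines X Y -> line_cover (v |: A) X Y.
Proof. by case=> sA leD vc; split=> //; rewrite subUset sub1set vc. Qed.

(** The cells off all lines belong to [D] and form a grid with sides at least [b - #|X|] and
    [a - #|Y|], so they pay for the remaining potential. *)
Lemma line_cover_full X Y :
  b <= m -> a <= n -> line_cover [set: 'I_m * 'I_n] X Y -> a * b <= #|D|.
Proof.
move=> le_bm le_an [sT leD].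
have leC : #|~: X| * #|~: Y| <= #|D :\: lines X Y|.
  rewrite -cardsX; apply: subset_leq_card; apply/subsetP=> v.
  rewrite !inE => /andP[vX vY].
  move/subsetP/(_ v (in_setT v)): sT.
  by rewrite !inE (negPf vX) (negPf vY) /= orbF.
have := cardsC X; have := cardsC Y; rewrite !card_ord -(cardsID (lines X Y) D).
move=> cY cX; apply: leq_trans leD _; rewrite leq_add2l.
by apply: leq_trans leC; apply: leq_mul; lia.
Qed.

Lemma rook_monopoly_card t :
    b <= m -> a <= n -> a + b <= t.+1 ->
  dynamic_monopoly (rook m n) t D -> a * b <= #|D|.
Proof.
move=> le_bm le_an le_t monD.
pose covered A := exists X Y, line_cover A X Y.
suff [X [Y]] : covered setT by exact: line_cover_full.
apply: (dynamic_monopoly_ind monD) => [|A v [X [Y cA]] tv].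
  by exists set0, set0; split; rewrite ?subsetUl // !cards0; lia.
have [vc|] := boolP (v \in D :|: lines X Y).
  by exists X, Y; apply: line_coverU1.
rewrite !inE !negb_or => /and3P[_ vX vY].
have [le_a|lt_a] := leqP a #|[set y | (v.1, y) \in A]|.
  (* The line is added before [v], so that its active cells are counted in [A] alone. *)
  exists (v.1 |: X), Y; apply: line_coverU1; last by rewrite !inE eqxx orbT.
  exact: line_cover_row.
exists X, (v.2 |: Y); apply: line_coverU1; last by rewrite !inE eqxx !orbT.
have le_t2 := leq_trans tv (rook_neighbors A v).
apply: line_cover_col => //; rewrite -(leq_add2l a); apply: leq_trans le_t _.
by apply: leq_ltn_trans le_t2 _; rewrite ltn_add2r.
Qed.

End LowerBound.

(** * Upper bound by two corner triangles *)

Section UpperBound.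

Lemma card_ord_ltn n k : k <= n -> #|[set x : 'I_n | x < k]| = k.
Proof.
move=> le_kn; rewrite -sum1dep_card (big_ord_narrow le_kn).
by rewrite sum1_card card_ord.
Qed.

Lemma card_ord_geq n k : #|[set x : 'I_n | k <= x]| = n - k.
Proof.
have [le_kn|lt_nk] := leqP k n.
  have := cardsC [set x : 'I_n | x < k]; rewrite card_ord_ltn // card_ord.
  rewrite (_ : ~: _ = [set x : 'I_n | k <= x]); first lia.
  by apply/setP=> x; rewrite !inE -leqNgt.
rewrite (_ : [set _ | _] = set0) ?cards0; first lia.
by apply/setP=> x; rewrite !inE; have := ltn_ord x; lia.
Qed.

Lemma sum_subn_triangle n p : p <= n ->
  2 * (\sum_(i < n) (i.+1 - p)) = (n - p) * (n - p).+1.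
Proof.
elim: n => [|n IHn] le_pn; first by rewrite big_ord0.
rewrite big_ord_recr /= mulnDr.
(* Here the induction hypothesis does not apply, but every term truncates to zero. *)
have [->|neq_p] := eqVneq p n.+1.
  rewrite big1 => [|i _]; last by have := ltn_ord i; lia.
  by rewrite subnn.
rewrite IHn; last lia.
have -> : n.+1 - p = (n - p).+1 by lia.
by nia.
Qed.

Definition off_band n p q :=
  [set v : 'I_n * 'I_n | (v.2 + p <= v.1) || (v.1 + q <= v.2)].

Lemma card_off_band n p q : 0 < p <= n -> 0 < q <= n ->
  2 * #|off_band n p q| <= (n - p) * (n - p).+1 + (n - q) * (n - q).+1.
Proof.
have triangle r : 0 < r <= n ->
    2 * #|[set v : 'I_n * 'I_n | v.2 + r <= v.1]| = (n - r) * (n - r).+1.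
  move=> /andP[r_gt0 le_rn]; rewrite -sum_subn_triangle // -sum1dep_card.
  rewrite -(pair_big_dep xpredT (fun i j : 'I_n => j + r <= i) (fun _ _ => 1)) /=.
  congr (2 * _); apply: eq_bigr => i _; rewrite sum1dep_card.
  rewrite -(@card_ord_ltn n (i.+1 - r)); last by have := ltn_ord i; lia.
  by apply: eq_card => j; rewrite !inE; lia.
move=> hp hq; rewrite -(triangle p hp) -(triangle q hq) -mulnDr leq_mul2l /=.
(* Transposition brings the second triangle to the form counted by [triangle]. *)
have swapK : involutive (fun v : 'I_n * 'I_n => (v.2, v.1)) by case.
set Q := [set v : 'I_n * 'I_n | v.2 + q <= v.1].
rewrite -(card_imset Q (inv_inj swapK)).
apply: leq_trans (leq_card_setU _ _); apply: subset_leq_card.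
apply/subsetP=> -[x y]; rewrite !inE /= => /orP[->//|hxy].
by apply/orP; right; apply/imsetP; exists (y, x); rewrite ?inE.
Qed.

(** [r < c + p] keeps the two ranges disjoint. Exchanging [c] and [r] turns the count for a row into
    the one for a column. *)
Lemma card_ord_off_interval n (c r p : nat) : c < n -> r < n -> r < c + p ->
  (n - c.+1) + (r.+1 - p) <= #|[set x : 'I_n | (c < x) || (x + p <= r)]|.
Proof.
move=> lt_cn lt_rn lt_rcp.
rewrite -(@card_ord_geq n c.+1) -(@card_ord_ltn n (r.+1 - p)); last lia.
apply: leq_card_disjointU => [||x]; rewrite ?inE; last by lia.
  by apply/subsetP=> x; rewrite !inE => ->.
by apply/subsetP=> x; rewrite !inE; lia.
Qed.

Lemma rook_off_band_monopoly n p q t : t + p + q <= 2 * n ->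
  dynamic_monopoly (rook n n) t (off_band n p q).
Proof.
move=> le_t; apply: dynamic_monopolyP => A sDA A_neqT.
have [v0 v0A] : exists v, v \notin A.
  apply/existsP; rewrite -negb_forall; apply: contraNN A_neqT => /forallP allA.
  by apply/eqP/setP=> v; rewrite inE allA.
(* An inactive cell with the largest coordinate sum: all cells further along its row and column are
   active. *)
case: (@arg_maxnP _ v0 (fun v => v \notin A) (fun v => v.1 + v.2) v0A).
move=> [r c] /= vA maxv; exists (r, c) => //.
have beyond (u : 'I_n * 'I_n) : r + c < u.1 + u.2 -> u \in A.
  by rewrite ltnNge; apply: contraNT => /maxv.
have : (r, c) \notin off_band n p q by apply: contraNN vA => /(subsetP sDA).
rewrite inE /= negb_or -!ltnNge => /andP[lt_r lt_c].
pose row := [set y : 'I_n | (c < y) || (y + p <= r)].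
pose col := [set x : 'I_n | (r < x) || (x + q <= c)].
have le_row := card_ord_off_interval (ltn_ord c) (ltn_ord r) lt_r.
have le_col := card_ord_off_interval (ltn_ord r) (ltn_ord c) lt_c.
have : #|row| + #|col| <= #|[set u in A | rook n n (r, c) u]|.
  rewrite -(card_row r row) -(card_col c col).
  apply: leq_card_disjointU => [||u].
  - apply/subsetP=> u /imsetP[y]; rewrite !inE /cart_prod /complete_graph /=.
    move=> hy ->; rewrite eqxx /=; apply/andP; split; last first.
      by apply/orP; left; apply/eqP=> e; move: hy; rewrite -e; lia.
    case/orP: hy => hy; first by apply: beyond; rewrite /=; lia.
    by apply: (subsetP sDA); rewrite inE hy.
  - apply/subsetP=> u /imsetP[x]; rewrite !inE /cart_prod /complete_graph /=.
    move=> hx ->; rewrite eqxx /=; apply/andP; split; last first.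
      by apply/orP; right; apply/eqP=> e; move: hx; rewrite -e; lia.
    case/orP: hx => hx; first by apply: beyond; rewrite /=; lia.
    by apply: (subsetP sDA); rewrite inE hx orbT.
  case/imsetP=> y hy ->; apply/imsetP=> -[x _ [_ e]].
  by move: hy; rewrite e inE; lia.
apply: leq_trans; rewrite -/row -/col in le_row le_col.
by have := ltn_ord r; have := ltn_ord c; lia.
Qed.

End UpperBound.

Lemma dyn_rook t n : 0 < t -> t <= 2 * n - 2 ->
  dyn (rook n n) t = uphalf t * (t./2).+1.
Proof.
move=> t_gt0 le_t.
have e : uphalf t + t./2 = t by rewrite uphalf_half; have := odd_double_half t; lia.
have parity : uphalf t = t./2 \/ uphalf t = (t./2).+1.
  by rewrite uphalf_half; case: (odd t); [right | left].
apply/eqP; rewrite eqn_leq; apply/andP; split; last first.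
  have [D monD <-] := dyn_attained (rook n n) t.
  (* [t <= 2 * n - 2] makes both [uphalf t] and [(t./2).+1] at most [n]. *)
  by apply: rook_monopoly_card monD; lia.
apply: leq_trans (dyn_min (@rook_off_band_monopoly n (n - t./2) (n - uphalf t) t _)) _.
  by lia.
have hp : 0 < n - t./2 <= n by lia.
have hq : 0 < n - uphalf t <= n by lia.
have := card_off_band hp hq.
have -> : n - (n - t./2) = t./2 by lia.
have -> : n - (n - uphalf t) = uphalf t by lia.
(* With [h = t./2] and [u = uphalf t], the sum [h * (h + 1) + u * (u + 1)] equals [2 * u * (h + 1)]
   for [u = h] and for [u = h + 1]. *)
by case: parity => ->; nia.
Qed.

Theorem theorem14 (t n : nat) (t_gt0 : 0 < t) (n_gt0 : 0 < n)
    (t_le : t <= 2 * n - 2) :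
  (odd t ->
     dyn (cart_prod (complete_graph n) (complete_graph n)) t = uphalf t ^ 2) /\
  (~~ odd t ->
     dyn (cart_prod (complete_graph n) (complete_graph n)) t
       = t./2 * (t./2 + 1)).
Proof.
rewrite dyn_rook //; split=> t_odd; rewrite uphalf_half.
  by rewrite t_odd add1n -mulnn.
by rewrite (negPf t_odd) addn1.
Qed.
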